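(* Let $A$ be a non-empty subset of $\mathbb{N}$ and let $B$ be a non-empty finite subset of $\mathbb{N}\setminus\{0\}$ such that $\langle A\rangle\cap B=\emptyset$. Let $C$ be a subset of $\mathbb{N}\setminus\{0\}$. Then $C\in\mathfrak{m}(A,B)$ if and only if $\mathbb{N}\setminus C\in\mathscr{M}(A,B)$.
   Context: $\mathbb{N}=\{0,1,2,\ldots\}$. For a non-empty $A\subseteq\mathbb{N}$, $\langle A\rangle$ is the submonoid of $(\mathbb{N},+)$ generated by $A$ (all finite non-negative integer linear combinations of elements of $A$). A numerical semigroup is a submonoid $S$ of $(\mathbb{N},+)$ with $\mathbb{N}\setminus S$ finite; $\mathscr{S}$ is the set of all numerical semigroups. A partition of a positive integer $b$ is an expression $b=x_1+\cdots+x_n$ with $n\geq 1$ and all $x_i$ positive integers (order irrelevant). Notation: - $\mathfrak{P}(B)=\{(x_1,\ldots,x_n)\mid x_1+\cdots+x_n \text{ is a partition of some element of } B\}$; - $\mathfrak{G}(A,B)=\{\{x_1,\ldots,x_n\}\setminus\langle A\rangle\mid (x_1,\ldots,x_n)\in\mathfrak{P}(B)\}$; - $\mathfrak{L}(A,B)=\{K\subseteq\mathbb{N}\setminus\{0\}\mid K\cap X\neq\emptyset\text{ for all }X\in\mathfrak{G}(A,B)\}$; - $\mathfrak{m}(A,B)$ is the set of elements of $\mathfrak{L}(A,B)$ that are minimal with respect to inclusion; - $\mathscr{S}(A,B)=\{S\in\mathscr{S}\mid A\subseteq S\text{ and }S\cap B=\emptyset\}$; - $\mathscr{M}(A,B)$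 is the set of elements of $\mathscr{S}(A,B)$ that are maximal with respect to inclusion. *)

(* Defs.v *)
From mathcomp Require Import all_boot.
From mathcomp Require Import all_classical.
Set Implicit Arguments. Unset Strict Implicit. Unset Printing Implicit Defensive.
Local Open Scope classical_set_scope.

Definition submonoid (S : set nat) : Prop :=
  S 0 /\ forall x y, S x -> S y -> S (x + y).

Definition generated (A : set nat) : set nat := smallest submonoid A.

(* The generated submonoid consists of the finite sums of elements of A, with
   repetitions, that is, of the non-negative integer combinations. *)
Lemma generatedE (A : set nat) :
  generated A = [set n | exists2 s : seq nat, [set` s] `<=` A & n = sumn s].
Proof.
apply/seteqP; split => [n gn | n [s sA ->] M [[M0 MD] AM]].
  apply: gn; split; last first.
    move=> a Aa; exists [:: a]; last by rewrite /= addn0.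
    by move=> x; rewrite /= inE => /eqP ->.
  split; first by exists [::].
  move=> x y [s sA ->] [t tA ->]; exists (s ++ t); last by rewrite sumn_cat.
  by move=> z; rewrite /= mem_cat => /orP[/sA | /tA].
elim: s sA => [//|a s IHs] sA /=; apply: MD.
  by apply/AM/sA; rewrite /= mem_head.
by apply: IHs => x xs; apply: sA; rewrite /= inE xs orbT.
Qed.

Definition numerical_semigroup (S : set nat) : Prop :=
  submonoid S /\ finite_set (~` S).

(* A partition is represented by any sequence listing its parts; every ordering
   of the parts is allowed, and only the set of parts is used below. *)
Definition is_partition (s : seq nat) (b : nat) : Prop :=
  [/\ s != [::], all (fun x => 0 < x) s & sumn s = b].

Definition partitions (B : set nat) : set (seq nat) :=
  [set s | exists2 b, B b & is_partition s b].

Definition part_sets (A B : set nat) : set (set nat) :=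
  [set [set` s] `\` generated A | s in partitions B].

Definition hitting_sets (A B : set nat) : set (set nat) :=
  [set K | K `<=` ~` [set 0] /\
           forall X, part_sets A B X -> K `&` X !=set0].

Definition minimal_members (T : Type) (F : set (set T)) : set (set T) :=
  [set X | F X /\ forall Y, F Y -> Y `<=` X -> Y = X].

Definition maximal_members (T : Type) (F : set (set T)) : set (set T) :=
  [set X | F X /\ forall Y, F Y -> X `<=` Y -> Y = X].

Definition minimal_hitting_sets (A B : set nat) : set (set nat) :=
  minimal_members (hitting_sets A B).

Definition semigroups_avoiding (A B : set nat) : set (set nat) :=
  [set S | [/\ numerical_semigroup S, A `<=` S & S `&` B = set0]].

Definition maximal_semigroups_avoiding (A B : set nat) : set (set nat) :=
  maximal_members (semigroups_avoiding A B).

(* Main.v *)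
Require Import Defs.
From mathcomp Require Import all_boot all_classical.
Local Open Scope classical_set_scope.

(** Complementation is an order-reversing passage between semigroups avoiding
    [B] and hitting sets, and it matches maximal members with minimal ones.

    One direction is direct ([hitting_sets_setC]): if [S] is a semigroup
    containing [A] and missing [B], a partition of an element of [B] cannot have
    all its parts in [S], and a part outside [S] is also outside [generated A].
    So the complement of [S] is a hitting set.

    The complement of a hitting set [K] need be neither additively closed nor
    cofinite, but it can be enlarged to a semigroup that still avoids [B]
    ([semigroups_avoiding_hull]): take the submonoid generated by [A], by the
    complement of [K], and by all numbers above [B].  An element [b] of [B] in
    that submonoid would have a partition with parts among these generators;
    the parts are at most [b], so they lie in [A] or outside [K], and those
    outside [generated A] form a set that [K] does not hit.  Hence every hitting
    set contains the complement of a semigroup avoiding [B], and the equivalence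
    of minimality and maximality is then purely order-theoretic. *)

Lemma generated_submonoid (A : set nat) : submonoid (generated A).
Proof.
split=> [M [[M0 _] _] //|x y gx gy M MA].
by have [[_ MD] _] := MA; apply: MD; [exact: gx|exact: gy].
Qed.

Lemma sub_generated (A : set nat) : A `<=` generated A.
Proof. exact: sub_smallest. Qed.

Lemma submonoid_sumn (S : set nat) (s : seq nat) :
  submonoid S -> [set` s] `<=` S -> S (sumn s).
Proof.
move=> mS sS; have: generated S (sumn s) by rewrite generatedE; exists s.
exact: smallest_sub.
Qed.

Lemma leq_mem_sumn (s : seq nat) (x : nat) : x \in s -> x <= sumn s.
Proof. by move=> /perm_to_rem/perm_sumn ->; exact: leq_addr. Qed.

(** Dropping the zero summands from a sum of generators leaves a partition. *)
Lemma generated_partition (A : set nat) (n : nat) : 0 < n -> generated A n ->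
  exists2 s, [set` s] `<=` A & is_partition s n.
Proof.
move=> n_gt0; rewrite generatedE => -[s sA nE].
have sumE : sumn [seq x <- s | 0 < x] = n.
  by rewrite nE; elim: s {sA nE} => //= -[|x] s IHs //=; rewrite IHs.
exists [seq x <- s | 0 < x].
  by move=> x /=; rewrite mem_filter => /andP[_ /sA].
split=> //; last exact: filter_all.
by apply: contraTneq n_gt0 => s0; rewrite -sumE s0.
Qed.

Lemma hitting_sets_setC (A B S : set nat) :
  semigroups_avoiding A B S -> hitting_sets A B (~` S).
Proof.
move=> [[mS _] AS SB]; split=> [x nSx x0|_ [s [b Bb [_ _ sb]] <-]].
  by apply: nSx; rewrite x0; exact: mS.1.
have gS : generated A `<=` S by exact: smallest_sub.
apply: contrapT => no_hit.
suff: (S `&` B) b by rewrite SB.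
split=> //; rewrite -sb; apply: submonoid_sumn => // x xs.
by apply: contrapT => nSx; apply: no_hit; exists x; split=> //; split=> // /gS.
Qed.

(** Adding the numbers above [B] to the generators makes the hull cofinite; they
    are too large to occur in a partition of an element of [B]. *)
Definition hull (A B K : set nat) : set nat :=
  generated (A `|` ~` K `|` [set n | forall b, B b -> b < n]).

Lemma setC_sub_hull (A B K : set nat) : ~` K `<=` hull A B K.
Proof. by move=> x nKx; apply: sub_generated; left; right. Qed.

Lemma hull_cofinite (A B K : set nat) :
  finite_set B -> finite_set (~` hull A B K).
Proof.
move=> finB; apply: (@sub_finite_set _ _ (\bigcup_(b in B) `I_b.+1)); last first.
  by apply: bigcup_finite => // b _; exact: finite_II.
move=> n hn; apply: contrapT => n_above; apply: hn; apply: sub_generated; right => b Bb.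
by rewrite ltnNge; apply/negP => nb; apply: n_above; exists b.
Qed.

Lemma semigroups_avoiding_hull (A B K : set nat) :
  finite_set B -> B `<=` ~` [set 0] -> hitting_sets A B K ->
  semigroups_avoiding A B (hull A B K).
Proof.
move=> finB B0 [_ Khit]; split.
- by split; [exact: generated_submonoid | exact: hull_cofinite].
- by move=> x Ax; apply: sub_generated; left; left.
apply/seteqP; split=> // b [hb Bb].
have b_gt0 : 0 < b by rewrite lt0n; apply/eqP; exact: B0.
have [s s_gens sb] := generated_partition _ _ b_gt0 hb.
have [|x [Kx [xs ngx]]] := Khit ([set` s] `\` generated A).
  by exists s => //; exists b.
have [[/sub_generated//|//]|/(_ b Bb)] := s_gens x xs.
by rewrite ltnNge; case: sb => _ _ <-; rewrite leq_mem_sumn.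
Qed.

Theorem theorem2p8 (A B C : set nat) (hA : A !=set0) (hB : B !=set0)
  (finB : finite_set B) (B0 : B `<=` ~` [set 0])
  (AB : generated A `&` B = set0) (C0 : C `<=` ~` [set 0]) :
  minimal_hitting_sets A B C <-> maximal_semigroups_avoiding A B (~` C).
Proof.
split=> [[hitC minC]|[avC maxC]].
  have avH := semigroups_avoiding_hull _ _ _ finB B0 hitC.
  (* By minimality, enlarging the complement of C to its hull adds nothing. *)
  have HC : ~` hull A B C = C.
    apply: minC; first exact: hitting_sets_setC.
    by apply: subsetCl; exact: setC_sub_hull.
  split=> [|Y avY CY]; first by rewrite -HC setCK.
  rewrite -(minC (~` Y)) ?setCK //; first exact: hitting_sets_setC.
  exact: subsetCl.
split=> [|Y hitY YC]; first by rewrite -(setCK C); exact: hitting_sets_setC.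
have CH : ~` C `<=` hull A B Y.
  by apply: subset_trans (setC_sub_hull _ _ _); exact: subsetC.
have HC : hull A B Y = ~` C.
  by apply: maxC => //; exact: semigroups_avoiding_hull.
apply/seteqP; split=> //; rewrite -[C]setCK -HC.
by apply: subsetCl; exact: setC_sub_hull.
Qed.
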